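(* Assume there is a proper class of supercompact cardinals. Let $R$ be a ring and let $(\mathcal{A},\mathcal{B})$ be a cotorsion pair of $R$-modules that is cogenerated by a set and such that $\mathcal{A}$ is closed under direct limits. Then $(\mathcal{A},\mathcal{B})$ is complete.
   Context: The background theory is ZFC. Modules are left $R$-modules. For a class $\mathcal{C}$ of $R$-modules, ${}^\perp\mathcal{C}=\{X : \mathrm{Ext}^1_R(X,C)=0 \text{ for all } C\in\mathcal{C}\}$ and $\mathcal{C}^\perp=\{Y : \mathrm{Ext}^1_R(C,Y)=0\text{ for all }C\in\mathcal{C}\}$. A cotorsion pair is a pair $(\mathcal{A},\mathcal{B})$ of classes of $R$-modules with $\mathcal{A}={}^\perp\mathcal{B}$ and $\mathcal{B}=\mathcal{A}^\perp$. It is complete if for every $R$-module $M$ there is a short exact sequence $0\to B\to A\to M\to 0$ with $A\in\mathcal{A}$ and $B\in\mathcal{B}$. It is cogenerated by a set if there is a set (not a proper class) $\mathcal{C}$ of $R$-modules with $(\mathcal{A},\mathcal{B})=({}^\perp\mathcal{C},({}^\perp\mathcal{C})^\perp)$. Direct limits are colimits over directed systems. *)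

(* Defs.v *)
From HB Require Import structures.
From mathcomp Require Import all_boot all_algebra.
From mathcomp Require Import boolp classical_sets functions cardinality filter.

Set Implicit Arguments.
Unset Strict Implicit.
Unset Printing Implicit Defensive.

Import GRing.Theory.
Local Open Scope ring_scope.
Local Open Scope classical_set_scope.
Local Open Scope card_scope.

(* [small] is one fixed universe: its inhabitants play the role of the sets of
   ZFC, and predicates on it (or on modules carried by it) that of classes. *)
Definition small := Type.

(* These four definitions have no content of their own: they make the universe
   [small] equal to that of the carriers of [pzRingType] and of [lmodType R].
   Otherwise an index "set" could be as large as the class of all modules, or
   the cardinals and the modules could live in universes of different sizes. *)
Definition small_of_ring (R : pzRingType) : small := R.
Definition ring_of_small (T : small) (c : GRing.PzRing.axioms_ T) :
  pzRingType := GRing.PzRing.Pack c.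
Definition small_of_module (R : pzRingType) (M : lmodType R) : small := M.
Definition module_of_small (R : pzRingType) (T : small)
  (c : GRing.Lmodule.axioms_ R T) : lmodType R := GRing.Lmodule.Pack c.

(* A cardinal is represented by any type of that cardinality.  [P_below K A] is
   P_kappa(A) for kappa = |K|: the subsets of A of cardinality < kappa ("not >= kappa", by choice). *)
Definition P_below (K A : small) : Type :=
  {s : set A | ~ ([set: K] #<= s)}.

(* Normal measure on P_kappa(A): a kappa-complete fine ultrafilter for which
   every regressive function is constant on a measure one set.  (When
   kappa <= |A|, fineness forces it to be nonprincipal.) *)
Record normal_measure (K A : small) (U : set_system (P_below K A)) : Prop := {
  measure_ultra : UltraFilter U;
  measure_complete : forall (S : small) (F : S -> set (P_below K A)),
    ~ ([set: K] #<= [set: S]) -> (forall s, U (F s)) -> U (\bigcap_s F s);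
  measure_fine : forall a : A, U [set p | sval p a];
  measure_normal : forall f : P_below K A -> A,
    U [set p | sval p (f p)] -> exists a : A, U [set p | f p = a] }.

Definition supercompact (K : small) : Prop :=
  ~ countable [set: K] /\
  forall A : small, [set: K] #<= [set: A] ->
    exists U : set_system (P_below K A), normal_measure U.

(* The cardinals satisfying P do not form a set. *)
Definition proper_class_of_cardinals (P : small -> Prop) : Prop :=
  ~ exists (I : small) (F : I -> small),
      forall K : small, P K -> exists i : I, [set: K] #= [set: F i].

Section Modules.

Variable R : pzRingType.

Definition module_class := lmodType R -> Prop.

Definition short_exact (B A M : lmodType R)
    (i : {linear B -> A}) (p : {linear A -> M}) : Prop :=
  [/\ injective i,
      forall a, p a = 0 <-> exists b, i b = a
    & forall m, exists a, p a = m].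

(* Ext^1_R(X, C) is the set of extensions of X by C modulo [ext_equiv], with
   zero the class of the split extension. *)
Record extension (X C : lmodType R) := Extension {
  ext_mid : lmodType R;
  ext_in : {linear C -> ext_mid};
  ext_out : {linear ext_mid -> X};
  ext_exact : short_exact ext_in ext_out }.

Definition ext_equiv (X C : lmodType R) (E E' : extension X C) : Prop :=
  exists f : {linear ext_mid E -> ext_mid E'},
    [/\ bijective f,
        forall c, f (ext_in E c) = ext_in E' c
      & forall e, ext_out E' (f e) = ext_out E e].

Definition inl_mod (X C : lmodType R) (c : C) : (C * X)%type := (c, 0).

Fact inl_mod_is_linear (X C : lmodType R) : linear (@inl_mod X C).
Proof.
move=> a u v; rewrite /inl_mod.
by apply/pair_equal_spec; split=> //=; rewrite scaler0 addr0.
Qed.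

HB.instance Definition _ (X C : lmodType R) :=
  GRing.isLinear.Build R C (C * X)%type _ (@inl_mod X C)
    (@inl_mod_is_linear X C).

Fact split_exact (X C : lmodType R) :
  short_exact (@inl_mod X C : {linear C -> (C * X)%type})
              (@snd C X : {linear (C * X)%type -> X}).
Proof.
split=> [c c' [] //|[c x]|x]; last by exists (0, x).
by split=> /= [->|[c' [_ ->]]] //; exists c.
Qed.

Definition split_extension (X C : lmodType R) : extension X C :=
  Extension (split_exact X C).

Definition Ext1_eq0 (X C : lmodType R) : Prop :=
  forall E : extension X C, ext_equiv E (split_extension X C).

Definition left_perp (C : module_class) : module_class :=
  fun X => forall Y, C Y -> Ext1_eq0 X Y.

Definition right_perp (C : module_class) : module_class :=
  fun Y => forall X, C X -> Ext1_eq0 X Y.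

Definition class_eq (C D : module_class) : Prop := forall M, C M <-> D M.

Definition cotorsion_pair (A B : module_class) : Prop :=
  class_eq A (left_perp B) /\ class_eq B (right_perp A).

Definition complete_pair (A B : module_class) : Prop :=
  forall M : lmodType R,
    exists (N P : lmodType R) (i : {linear N -> P}) (p : {linear P -> M}),
      [/\ B N, A P & short_exact i p].

Definition cogenerated_by_set (A B : module_class) : Prop :=
  exists (I : small) (F : I -> lmodType R),
    let C : module_class := fun M => exists i, F i = M in
    class_eq A (left_perp C) /\ class_eq B (right_perp (left_perp C)).

Record directed_system := DirectedSystem {
  ds_idx : small;
  ds_le : ds_idx -> ds_idx -> Prop;
  ds_refl : forall i, ds_le i i;
  ds_anti : forall i j, ds_le i j -> ds_le j i -> i = j;
  ds_trans : forall i j k, ds_le i j -> ds_le j k -> ds_le i k;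
  ds_nonempty : exists i : ds_idx, True;
  ds_directed : forall i j, exists k, ds_le i k /\ ds_le j k;
  ds_mod : ds_idx -> lmodType R;
  ds_map : forall i j, ds_le i j -> {linear ds_mod i -> ds_mod j};
  ds_map_id : forall i (h : ds_le i i) x, ds_map h x = x;
  ds_map_comp : forall i j k (h : ds_le i j) (h' : ds_le j k)
    (h'' : ds_le i k) x, ds_map h'' x = ds_map h' (ds_map h x) }.

Definition is_cocone (D : directed_system) (L : lmodType R)
    (u : forall i, {linear @ds_mod D i -> L}) : Prop :=
  forall i j (h : ds_le i j) x, u j (ds_map h x) = u i x.

Definition is_direct_limit (D : directed_system) (L : lmodType R)
    (u : forall i, {linear @ds_mod D i -> L}) : Prop :=
  is_cocone u /\
  forall (N : lmodType R) (v : forall i, {linear @ds_mod D i -> N}),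
    is_cocone v ->
    exists g : {linear L -> N},
      (forall i x, g (u i x) = v i x) /\
      (forall g' : {linear L -> N},
         (forall i x, g' (u i x) = v i x) -> g' =1 g).

Definition closed_under_direct_limits (A : module_class) : Prop :=
  forall (D : directed_system) (L : lmodType R)
    (u : forall i, {linear @ds_mod D i -> L}),
    (forall i, A (@ds_mod D i)) -> is_direct_limit u -> A L.

End Modules.

(* Main.v *)
Require Import Defs.
From HB Require Import structures.
From mathcomp Require Import all_boot all_algebra.
From mathcomp Require Import boolp classical_sets functions cardinality filter.

(* Let (A, B) be cogenerated by the family F, and let K be a supercompact
   cardinal larger than R, than the index type of F and than each F i.

   Reflection.  For V in A, let phi : X -> V be a surjection from a free module,
   with kernel N, and take a normal measure on P_K(X).  If for almost every p
   some h_p from p meet N to F i does not extend to X, then, F i being small, the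
   h_p cohere on almost every p to a single h : N -> F i, which extends since
   Ext^1(V, F i) = 0, a contradiction; so phi(p) is in A for almost every p.  In
   the same way maps phi(p) -> F i extend to V for almost every p, so V / phi(p)
   is in A.  Thus a nonzero V in A has a nonzero submodule with fewer than K
   elements, in A and with quotient in A.

   Filtration.  As A is closed under direct limits, Zorn's lemma then shows that
   a module E is in B as soon as every map Z -> E extends to L, where L is free
   on K and Z runs over the submodules of L with L / Z in A.

   Approximation.  For M, adjoin to a free cover of M freely all extensions to L
   of maps from such Z into the kernel.  The result maps onto M with a kernel in
   B by the criterion above, and it is in A because a map from its relations to
   a member of B extends step by step to the generators. *)

Set Implicit Arguments.
Unset Strict Implicit.
Unset Printing Implicit Defensive.

Import GRing.Theory.
Local Open Scope ring_scope.
Local Open Scope classical_set_scope.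
Local Open Scope card_scope.

(** * Constructions of modules *)

Section QuotientModule.
Variable R : pzRingType.

(** Quotients, submodules and free modules are each given as a carrier with a congruence, so that
    passing to classes and checking the module axioms is done only once. *)
Record premodule := Premodule {
  pm_car : Type;
  pm_eq : pm_car -> pm_car -> Prop;
  pm_zero : pm_car;
  pm_opp : pm_car -> pm_car;
  pm_add : pm_car -> pm_car -> pm_car;
  pm_scale : R -> pm_car -> pm_car;
  pm_refl : forall x, pm_eq x x;
  pm_sym : forall x y, pm_eq x y -> pm_eq y x;
  pm_trans : forall x y z, pm_eq x y -> pm_eq y z -> pm_eq x z;
  pm_addE : forall x x' y y', pm_eq x x' -> pm_eq y y' ->
    pm_eq (pm_add x y) (pm_add x' y');
  pm_oppE : forall x x', pm_eq x x' -> pm_eq (pm_opp x) (pm_opp x');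
  pm_scaleE : forall a x x', pm_eq x x' ->
    pm_eq (pm_scale a x) (pm_scale a x');
  pm_addA : forall x y z,
    pm_eq (pm_add x (pm_add y z)) (pm_add (pm_add x y) z);
  pm_addC : forall x y, pm_eq (pm_add x y) (pm_add y x);
  pm_add0 : forall x, pm_eq (pm_add pm_zero x) x;
  pm_addN : forall x, pm_eq (pm_add (pm_opp x) x) pm_zero;
  pm_scaleA : forall a b x,
    pm_eq (pm_scale a (pm_scale b x)) (pm_scale (a * b) x);
  pm_scale1 : forall x, pm_eq (pm_scale 1 x) x;
  pm_scaleDr : forall a x y,
    pm_eq (pm_scale a (pm_add x y)) (pm_add (pm_scale a x) (pm_scale a y));
  pm_scaleDl : forall a b x,
    pm_eq (pm_scale (a + b) x) (pm_add (pm_scale a x) (pm_scale b x)) }.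

Variable p : premodule.

Definition pm_quot := {c : set (pm_car p) | exists x, c = pm_eq x}.

HB.instance Definition _ := gen_eqMixin pm_quot.
HB.instance Definition _ := gen_choiceMixin pm_quot.

Definition pm_class (x : pm_car p) : pm_quot :=
  exist _ (pm_eq x) (ex_intro _ x erefl).

Lemma pm_classP x y : pm_class x = pm_class y <-> pm_eq x y.
Proof.
split=> [/(congr1 sval) /= E|xy]; first by rewrite E; exact: pm_refl.
apply: eq_exist; apply/seteqP; split=> z /=; last exact: pm_trans.
exact: pm_trans (pm_sym xy).
Qed.

Definition pm_repr (c : pm_quot) : pm_car p := sval (cid (svalP c)).

Lemma pm_reprK c : pm_class (pm_repr c) = c.
Proof.
case: c => c hc; apply: eq_exist; rewrite /pm_repr.
by case: cid => x /= ->.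
Qed.

Lemma pm_repr_class x : pm_eq (pm_repr (pm_class x)) x.
Proof. by apply/pm_classP; rewrite pm_reprK. Qed.

Let add c d := pm_class (pm_add (pm_repr c) (pm_repr d)).
Let opp c := pm_class (pm_opp (pm_repr c)).
Let scale a c := pm_class (pm_scale a (pm_repr c)).

Let addE x y : add (pm_class x) (pm_class y) = pm_class (pm_add x y).
Proof. by apply/pm_classP/pm_addE; apply: pm_repr_class. Qed.
Let oppE x : opp (pm_class x) = pm_class (pm_opp x).
Proof. by apply/pm_classP/pm_oppE/pm_repr_class. Qed.
Let scaleE a x : scale a (pm_class x) = pm_class (pm_scale a x).
Proof. by apply/pm_classP/pm_scaleE/pm_repr_class. Qed.

Let addA : associative add.
Proof.
move=> x y z; rewrite -(pm_reprK x) -(pm_reprK y) -(pm_reprK z) !addE.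
exact/pm_classP/pm_addA.
Qed.
Let addC : commutative add.
Proof. by move=> x y; apply/pm_classP/pm_addC. Qed.
Let add0 : left_id (pm_class (pm_zero p)) add.
Proof.
by move=> x; rewrite -(pm_reprK x) addE; apply/pm_classP/pm_add0.
Qed.
Let addN : left_inverse (pm_class (pm_zero p)) opp add.
Proof.
by move=> x; rewrite -(pm_reprK x) oppE addE; apply/pm_classP/pm_addN.
Qed.
HB.instance Definition _ := GRing.isZmodule.Build pm_quot addA addC add0 addN.

Let classD x y : pm_class x + pm_class y = pm_class (pm_add x y).
Proof. exact: addE. Qed.

Let scaleA a b v : scale a (scale b v) = scale (a * b) v.
Proof. by rewrite -(pm_reprK v) !scaleE; apply/pm_classP/pm_scaleA. Qed.
Let scale1 : left_id 1 scale.
Proof.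
by move=> v; rewrite -(pm_reprK v) scaleE; apply/pm_classP/pm_scale1.
Qed.
Let scaleDr : right_distributive scale +%R.
Proof.
move=> a x y; rewrite -(pm_reprK x) -(pm_reprK y) classD !scaleE classD.
exact/pm_classP/pm_scaleDr.
Qed.
Let scaleDl v : {morph scale^~ v : a b / a + b}.
Proof.
move=> a b /=; rewrite -(pm_reprK v) !scaleE classD.
exact/pm_classP/pm_scaleDl.
Qed.
HB.instance Definition _ :=
  GRing.Zmodule_isLmodule.Build R pm_quot scaleA scale1 scaleDr scaleDl.

Lemma premodule_quotient : exists (Q : lmodType R) (c : pm_car p -> Q),
  [/\ forall q, exists x, c x = q, forall x y, c x = c y <-> pm_eq x y,
      forall x y, c (pm_add x y) = c x + c y
    & forall a x, c (pm_scale a x) = a *: c x].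
Proof.
exists pm_quot, pm_class; split=> [q|x y|x y|a x].
- by exists (pm_repr q); exact: pm_reprK.
- exact: pm_classP.
- by rewrite classD.
- by rewrite [RHS]scaleE.
Qed.

End QuotientModule.

(** * Submodules, quotients, formal linear combinations and free modules *)

Section Submodules.
Variable R : pzRingType.
Implicit Types U V W : lmodType R.

Definition submodule V (Z : set V) :=
  Z 0 /\ forall (a : R) x y, Z x -> Z y -> Z (a *: x + y).

(** A map out of [Z] is encoded as a total function with arbitrary values off [Z], so that [Z] need
    not be turned into a module. *)
Definition linear_on V W (Z : set V) (f : V -> W) :=
  forall (a : R) x y, Z x -> Z y -> f (a *: x + y) = a *: f x + f y.

Lemma bundle_linear V W (f : V -> W) :
  linear f -> exists g : {linear V -> W}, g =1 f.
Proof.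
move=> h; pose m := GRing.isLinear.Build R V W _ f h.
by pose g : {linear V -> W} := HB.pack f m; exists g.
Qed.

Section Closure.
Variables (V : lmodType R) (Z : set V).
Hypothesis hZ : submodule Z.

Lemma submodule0 : Z 0. Proof. by case: hZ. Qed.
Lemma submoduleD x y : Z x -> Z y -> Z (x + y).
Proof. by move=> zx zy; rewrite -[x]scale1r; apply: hZ.2. Qed.
Lemma submoduleZ a x : Z x -> Z (a *: x).
Proof.
by move=> zx; rewrite -[_ *: _]addr0; apply: hZ.2 => //; exact: submodule0.
Qed.
Lemma submoduleN x : Z x -> Z (- x).
Proof. by rewrite -scaleN1r; exact: submoduleZ. Qed.
Lemma submoduleB x y : Z x -> Z y -> Z (x - y).
Proof. by move=> zx zy; apply: submoduleD => //; exact: submoduleN. Qed.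
End Closure.

Lemma linear_on0 V W (Z : set V) (f : V -> W) :
  submodule Z -> linear_on Z f -> f 0 = 0.
Proof.
move=> hZ hf; have := hf 1 0 0 (submodule0 hZ) (submodule0 hZ).
by rewrite !scale1r addr0 => /(congr1 (+%R^~ (- f 0))); rewrite addrK subrr.
Qed.

Lemma linear_onB V W (Z : set V) (f : V -> W) x y :
  linear_on Z f -> Z x -> Z y -> f (x - y) = f x - f y.
Proof.
by move=> hf zx zy; rewrite addrC -scaleN1r hf // scaleN1r addrC.
Qed.

Lemma submodule_ker V W (f : {linear V -> W}) : submodule [set x | f x = 0].
Proof.
split=> [|a x y /= fx fy]; rewrite /= ?linear0 //.
by rewrite linearP fx fy scaler0 addr0.
Qed.

Lemma quotient_exists V (Z : set V) : submodule Z ->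
  exists (Q : lmodType R) (p : {linear V -> Q}),
    (forall q, exists x, p x = q) /\ (forall x, p x = 0 <-> Z x).
Proof.
move=> hZ.
have sub_trans x y z : Z (x - y) -> Z (y - z) -> Z (x - z).
  by move=> h1 h2; rewrite -(subrKA y); exact: submoduleD.
unshelve epose (pm := @Premodule R V (fun x y => Z (x - y)) 0 -%R +%R ( *:%R)
    _ _ _ _ _ _ _ _ _ _ _ _ _ _); rewrite /=.
  - by move=> x; rewrite subrr; exact: submodule0.
  - by move=> x y; rewrite -opprB => /(submoduleN hZ); rewrite opprK.
  - by move=> x y z; exact: sub_trans.
  - by move=> x x' y y' hx hy; rewrite opprD addrACA; exact: submoduleD.
  - by move=> x x' /(submoduleN hZ); rewrite opprD.
  - by move=> a x x' /(submoduleZ hZ a); rewrite scalerBr.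
  - by move=> x y z; rewrite [x + (y + z)]addrA subrr; exact: submodule0.
  - by move=> x y; rewrite [x + y]addrC subrr; exact: submodule0.
  - by move=> x; rewrite add0r subrr; exact: submodule0.
  - by move=> x; rewrite addNr subrr; exact: submodule0.
  - by move=> a b x; rewrite scalerA subrr; exact: submodule0.
  - by move=> x; rewrite scale1r subrr; exact: submodule0.
  - by move=> a x y; rewrite scalerDr subrr; exact: submodule0.
  - by move=> a b x; rewrite scalerDl subrr; exact: submodule0.
have [Q [c [csurj cE cD cZ]]] := premodule_quotient pm.
have clin : linear (c : V -> Q) by move=> a x y; rewrite cD cZ.
have [p pE] := bundle_linear clin.
exists Q, p; split=> [q|x]; first by have [x <-] := csurj q; exists x.
have c0 : c 0 = 0 :> Q by rewrite -(linear0 p) pE.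
by rewrite pE -[0]c0 cE /= subr0.
Qed.

Lemma submodule_exists V (Z : set V) : submodule Z ->
  exists (S : lmodType R) (i : {linear S -> V}),
    injective i /\ (forall x, Z x <-> exists s, i s = x).
Proof.
move=> hZ.
pose zero : {x | Z x} := exist _ 0 (submodule0 hZ).
pose opp (s : {x | Z x}) : {x | Z x} := exist _ _ (submoduleN hZ (svalP s)).
pose add (s t : {x | Z x}) : {x | Z x} :=
  exist _ _ (submoduleD hZ (svalP s) (svalP t)).
pose scale a (s : {x | Z x}) : {x | Z x} :=
  exist _ _ (submoduleZ hZ a (svalP s)).
unshelve epose (pm := @Premodule R {x | Z x} (fun s t => sval s = sval t)
    zero opp add scale _ _ _ _ _ _ _ _ _ _ _ _ _ _); rewrite /=.
  - by [].
  - by [].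
  - by move=> x y z ->.
  - by move=> x x' y y' -> ->.
  - by move=> x x' ->.
  - by move=> a x x' ->.
  - by move=> x y z; rewrite addrA.
  - by move=> x y; rewrite addrC.
  - by move=> x; rewrite add0r.
  - by move=> x; rewrite addNr.
  - by move=> a b x; rewrite scalerA.
  - by move=> x; rewrite scale1r.
  - by move=> a x y; rewrite scalerDr.
  - by move=> a b x; rewrite scalerDl.
have [S [c [csurj cE cD cZ]]] := premodule_quotient pm.
have [r rK] := choice csurj.
have rc s : sval (r (c s)) = sval s by apply/cE; rewrite rK.
have lin : linear (fun s => sval (r s) : V).
  move=> a s t; rewrite -{1}(rK s) -{1}(rK t).
  by rewrite -(cZ a) -(cD (pm_scale a (r s) : pm_car pm)) rc.
have [i iE] := bundle_linear lin.
exists S, i; split=> [s t|x].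
  by rewrite !iE => /cE; rewrite !rK.
split=> [zx|[s <-]]; last by rewrite iE; exact: svalP.
by exists (c (exist _ x zx)); rewrite iE rc.
Qed.

Definition comb (T : Type) V (f : T -> V) (s : seq (R * T)) : V :=
  foldr (fun u acc => u.1 *: f u.2 + acc) 0 s.

Lemma comb_cat T V (f : T -> V) s t :
  comb f (s ++ t) = comb f s + comb f t.
Proof. by elim: s => [|u s IH] /=; rewrite ?add0r // IH addrA. Qed.

Lemma comb_scale T V (f : T -> V) a s :
  comb f [seq (a * u.1, u.2) | u <- s] = a *: comb f s.
Proof.
by elim: s => [|u s IH] /=; rewrite ?scaler0 // IH scalerDr scalerA.
Qed.

Lemma linear_comb T V W (f : T -> V) (g : {linear V -> W}) s :
  g (comb f s) = comb (g \o f) s.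
Proof. by elim: s => [|u s IH] /=; rewrite ?linear0 // linearP IH. Qed.

Lemma eq_comb T V (f g : T -> V) s : f =1 g -> comb f s = comb g s.
Proof. by move=> fg; elim: s => [|u s IH] //=; rewrite IH fg. Qed.

(** Uniqueness of the extension [g] comes from the generation clause, see [is_free_eq]. *)
Definition is_free (T : Type) (L : lmodType R) (d : T -> L) :=
  (forall x, exists s, x = comb d s) /\
  forall V (f : T -> V), exists g : {linear L -> V}, forall t, g (d t) = f t.

(* Identifying the formal combinations that agree under every map to every
   module makes the universal property immediate. *)
Lemma free_exists (T : Type) : exists (L : lmodType R) (d : T -> L), is_free d.
Proof.
pose scale (a : R) (s : seq (R * T)) := [seq (a * u.1, u.2) | u <- s].
unshelve epose (pm := @Premodule R (seq (R * T))
    (fun s t => forall V (f : T -> V), comb f s = comb f t) [::]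
    (scale (-1)) cat scale _ _ _ _ _ _ _ _ _ _ _ _ _ _); rewrite /=.
  - by [].
  - by [].
  - by move=> x y z h h' V f; rewrite h h'.
  - by move=> x x' y y' h h' V f; rewrite !comb_cat h h'.
  - by move=> x x' h V f; rewrite !comb_scale h.
  - by move=> a x x' h V f; rewrite !comb_scale h.
  - by move=> x y z V f; rewrite catA.
  - by move=> x y V f; rewrite !comb_cat addrC.
  - by [].
  - by move=> x V f; rewrite comb_cat comb_scale scaleN1r addNr.
  - by move=> a b x V f; rewrite !comb_scale scalerA.
  - by move=> x V f; rewrite comb_scale scale1r.
  - by move=> a x y V f; rewrite comb_scale !comb_cat scalerDr !comb_scale.
  - by move=> a b x V f; rewrite comb_cat !comb_scale scalerDl.
have [L [c [csurj cE cD cZ]]] := premodule_quotient pm.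
have c0 : c [::] = 0.
  have := cZ 0 [::]; rewrite scale0r => <-; exact/cE.
pose d t := c [:: (1, t)] : L.
have combE s : comb d s = c s.
  elim: s => [|[a t] s IH] /=; first by rewrite c0.
  rewrite IH -cZ -cD; apply/cE => V f /=.
  by rewrite mulr1.
exists L, d; split=> [x|V f].
  by have [s <-] := csurj x; exists s; rewrite combE.
have [r rK] := choice csurj.
have rc s : comb f (r (c s)) = comb f s.
  by have /cE := rK (c s); apply.
have lin : linear (fun x => comb f (r x)).
  move=> a x y; rewrite -{1}(rK x) -{1}(rK y) -(cZ a) -cD rc.
  by rewrite [LHS]comb_cat [X in X + _]comb_scale.
have [g gE] := bundle_linear lin.
by exists g => t; rewrite gE rc /= scale1r addr0.
Qed.

End Submodules.

(** * Ext and extension of homomorphisms *)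

Section Extensions.
Variable R : pzRingType.
Implicit Types C L Q V W X : lmodType R.

(** Surjectivity of the restriction Hom(V, C) -> Hom(Z, C). For free [V] it amounts to Ext^1(V / Z,
    C) = 0, and most vanishing statements below are handled in this form. *)
Definition hom_ext V (Z : set V) C :=
  forall f : V -> C, linear_on Z f ->
    exists g : {linear V -> C}, forall x, Z x -> g x = f x.

(** A retraction [r] makes [e |-> (r e, ext_out E e)] an isomorphism with the split extension. *)
Lemma Ext1_eq0P X C : Ext1_eq0 X C <->
  forall E : extension X C,
    exists r : {linear ext_mid E -> C}, forall c, r (ext_in E c) = c.
Proof.
split=> h E.
  have [f [_ fin _]] := h E.
  have lin : linear (fun e => (f e).1) by move=> a x y; rewrite linearP.
  have [r rE] := bundle_linear lin.
  by exists r => c; rewrite rE fin.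
have [r rK] := h E; have [iinj pker psurj] := ext_exact E.
have lin : linear (fun e => (r e, ext_out E e) : (C * X)%type).
  by move=> a x y; rewrite !linearP.
have [f fE] := bundle_linear lin.
have finj : injective f.
  move=> x y; rewrite !fE => -[rxy pxy].
  have /pker[c ic] : ext_out E (x - y) = 0 by rewrite linearB pxy subrr.
  apply/subr0_eq; rewrite -ic -(rK c) ic linearB rxy subrr.
  by rewrite linear0.
have fsurj (y : C * X) : exists x, f x = y.
  case: y => c x; have [e <-] := psurj x.
  exists (e - ext_in E (r e) + ext_in E c); rewrite fE.
  have p0 c' : ext_out E (ext_in E c') = 0 by apply/pker; exists c'.
  by rewrite !(linearD, linearN) !rK !p0 subrr add0r oppr0 !addr0.
have [g gK] := choice fsurj.
exists f; split.
- by exists g => // x; apply: finj; rewrite gK.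
- move=> c; rewrite fE rK /= /inl_mod; congr (_, _).
  by apply/pker; exists c.
- by move=> e; rewrite fE.
Qed.

(* A map [f] on the kernel extends because the pushout of the presentation along
   [f] splits. *)
Lemma Ext1_eq0_hom_ext V Q C (p : {linear V -> Q}) :
  (forall q, exists x, p x = q) -> Ext1_eq0 Q C ->
  hom_ext [set x | p x = 0] C.
Proof.
move=> psurj /Ext1_eq0P hQ f flin.
have kerS := submodule_ker p.
(* The sign identifies [(f x, 0)] with [(0, x)] modulo [D] for [x] in the kernel of [p]. *)
pose D : set (C * V)%type := [set u | p u.2 = 0 /\ u.1 = - f u.2].
have hD : submodule D.
  split=> [|a [c x] [c' x'] [/= px ->] [/= px' ->]].
    by split; [exact: linear0|rewrite /= (linear_on0 kerS flin) oppr0].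
  split; first by rewrite /= linearP px px' scaler0 addr0.
  by rewrite /= flin // scalerN opprD.
have [Y [y [ysurj y0]]] := quotient_exists hD.
have ilin : linear (fun c : C => y (c, 0)).
  move=> a c c'; rewrite -linearP; congr (y _).
  by apply/pair_equal_spec; rewrite /= scaler0 addr0.
have [i iE] := bundle_linear ilin.
have [s sK] := choice ysurj.
have well u v : y u = y v -> p u.2 = p v.2.
  move=> yuv; apply/subr0_eq; rewrite -linearB.
  by have [] : D (u - v) by apply/y0; rewrite linearB yuv subrr.
have olin : linear (fun e : Y => p (s e).2).
  move=> a e e'; rewrite -linearP.
  by apply: (well _ (a *: s e + s e')); rewrite linearP !sK.
have [o oE] := bundle_linear olin.
have oyE u : o (y u) = p u.2 by rewrite oE; apply: well; rewrite sK.
have exE : short_exact i o.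
  split.
  - move=> c c'; rewrite !iE => yy; apply/subr0_eq.
    have [_ /= ->] : D ((c, 0) - (c', 0)) by apply/y0; rewrite linearB yy subrr.
    by rewrite subr0 (linear_on0 kerS flin) oppr0.
  - move=> e; split=> [|[c <-]]; last by rewrite iE oyE linear0.
    have [[c x] <-] := ysurj e; rewrite oyE /= => px.
    exists (c + f x); rewrite iE; apply/subr0_eq; rewrite -linearB; apply/y0.
    split; first by rewrite /= sub0r linearN px oppr0.
    rewrite /= (linear_onB flin (submodule0 kerS) px) (linear_on0 kerS flin).
    by rewrite sub0r opprK addrC addKr.
  - by move=> q; have [x <-] := psurj q; exists (y (0, x)); rewrite oyE.
have [r /= rK] := hQ (Extension exE).
have glin : linear (fun x => r (y (0, x)) : C).
  move=> a x x'; rewrite -!linearP; congr (r (y _)).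
  by apply/pair_equal_spec; rewrite /= scaler0 addr0.
have [g gE] := bundle_linear glin.
exists g => x px; rewrite gE -[RHS]rK iE; congr (r _).
apply/subr0_eq; rewrite -linearB; apply/y0; split=> /=; first by rewrite subr0.
by rewrite sub0r subr0.
Qed.

(** Let [g] lift [p] to [E] and let [h] extend [g] from the kernel of [p]. The retraction sends [e]
    to [(e - g s) + h s] for any [s] with the same image in [Q] as [e]; the choice of [s] is
    immaterial because [g] and [h] agree on the kernel. Asking for lifts instead of a basis of [V]
    suits the submodule in [Ext1_eq0_image]. *)
Lemma hom_ext_Ext1_eq0 V Q C (p : {linear V -> Q}) :
  (forall q, exists x, p x = q) ->
  (forall E : extension Q C, exists g : {linear V -> ext_mid E},
     forall x, ext_out E (g x) = p x) ->
  hom_ext [set x | p x = 0] C -> Ext1_eq0 Q C.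
Proof.
move=> psurj lift hp; apply/Ext1_eq0P => E.
have [iinj oker osurj] := ext_exact E.
have [g gE] := lift E.
have ker_in e : exists c, ext_out E e = 0 -> ext_in E c = e.
  have [/oker[c ?]|ne] := pselect (ext_out E e = 0); first by exists c.
  by exists 0 => /ne.
have [j jE] := choice ker_in.
have flin : linear_on [set x | p x = 0] (j \o g).
  move=> a x y /= px py; apply: iinj; rewrite [RHS]linearP !jE ?gE //.
    by rewrite linearP.
  by rewrite linearP px py scaler0 addr0.
have [h hE] := hp _ flin.
have pre e : exists x, p x = ext_out E e by exact: psurj.
have [s sE] := choice pre.
have key e x : p x = ext_out E e ->
    j (e - g (s e)) + h (s e) = j (e - g x) + h x.
  move=> px.
  have pz : p (s e - x) = 0 by rewrite linearB sE px subrr.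
  have ->: s e = (s e - x) + x by rewrite subrK.
  move: (s e - x) pz => z pz; rewrite !linearD addrA; congr (_ + _).
  rewrite hE //=; apply: iinj; rewrite [LHS]linearD !jE ?gE //.
  - by rewrite addrA addrAC subrK.
  - by rewrite linearB gE px subrr.
  - by rewrite !(linearD, linearN) !gE pz oppr0 add0r px subrr.
have rlin : linear (fun e => j (e - g (s e)) + h (s e)).
  move=> a e e'; rewrite (key _ (a *: s e + s e')); last first.
    by rewrite !linearP !sE.
  rewrite [h _]linearP scalerDr addrACA; congr (_ + _).
  have o0 e1 : ext_out E (e1 - g (s e1)) = 0 by rewrite linearB gE sE subrr.
  apply: iinj; rewrite [RHS]linearP !jE //.
    by rewrite linearP scalerBr opprD addrACA.
  by rewrite linearB gE [p _]linearP !sE linearP subrr.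
have [r rE] := bundle_linear rlin.
exists r => c; rewrite rE (key _ 0); last first.
  by rewrite linear0; apply/esym/oker; exists c.
rewrite !linear0 !addr0; apply: iinj; apply: jE.
by apply/oker; exists c.
Qed.

Lemma free_lift (T : Type) L (d : T -> L) V X (q : {linear V -> X})
    (f : {linear L -> X}) :
  is_free d -> (forall x, exists v, q v = x) ->
  exists g : {linear L -> V}, forall x, q (g x) = f x.
Proof.
move=> [gen univ] qsurj.
have [s sK] := choice qsurj.
have [g gE] := univ V (fun t => s (f (d t))).
exists g => x; have [u ->] := gen x; rewrite !linear_comb.
by apply: eq_comb => t /=; rewrite gE sK.
Qed.

Lemma free_hom_ext_Ext1_eq0 (T : Type) L (d : T -> L) Q C
    (p : {linear L -> Q}) :
  is_free d -> (forall q, exists x, p x = q) ->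
  hom_ext [set x | p x = 0] C -> Ext1_eq0 Q C.
Proof.
move=> freeL psurj; apply: hom_ext_Ext1_eq0 => // E.
by apply: free_lift freeL _; have [] := ext_exact E.
Qed.

End Extensions.

(** * Approximations *)

Section Factorization.
Variable R : pzRingType.
Implicit Types L V W : lmodType R.

Lemma factor V W L (q : {linear V -> W}) (f : {linear V -> L}) :
  (forall w, exists x, q x = w) -> (forall x, q x = 0 -> f x = 0) ->
  exists g : {linear W -> L}, forall x, g (q x) = f x.
Proof.
move=> qsurj kerq; have [s sK] := choice qsurj.
have well x y : q x = q y -> f x = f y.
  by move=> qxy; apply/subr0_eq; rewrite -linearB kerq // linearB qxy subrr.
have glin : linear (fun w => f (s w)).
  by move=> a w w'; rewrite -linearP; apply: well; rewrite linearP !sK.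
have [g gE] := bundle_linear glin.
by exists g => x; rewrite gE; apply: well; rewrite sK.
Qed.

Lemma is_free_eq (T : Type) L (d : T -> L) V (f g : {linear L -> V}) :
  is_free d -> (forall t, f (d t) = g (d t)) -> f =1 g.
Proof.
move=> [gen _] fg x; have [s ->] := gen x.
by rewrite !linear_comb (eq_comb _ fg).
Qed.

End Factorization.

(* The generators of the approximation of [M]: [Node Z h k] is the [k]-th basis
   vector of the copy of [F] that receives the extension of the map from [Z]
   represented by [h].  These well-founded trees replace the transfinite
   iteration of pushouts in the small object argument. *)
Inductive tree (S M F K : Type) : Type :=
| Base (m : M)
| Node (Z : set F) (h : F -> seq (S * tree S M F K)) (k : K).

Section Precover.
Variables (R : pzRingType) (K : Type) (F : lmodType R) (d : K -> F).
Hypothesis freeF : is_free d.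
Variables (B : module_class R) (M : lmodType R).

Let G := tree R M F K.
Variables (L : lmodType R) (b : G -> L).
Hypothesis freeL : is_free b.

Variable nu : set F -> (F -> seq (R * G)) -> {linear F -> L}.
Hypothesis nuE : forall Z h k, nu Z h (d k) = b (Node Z h k).

Variable pi : {linear L -> M}.
Hypothesis pi_base : forall m, pi (b (Base _ _ _ m)) = m.
Hypothesis pi_node : forall Z h k, pi (b (Node Z h k)) = 0.

(* [Node Z h] gets relations only when [h] is linear on [Z] modulo [rel] itself,
   a positive condition; otherwise it only adds a free summand. *)
Inductive rel : L -> Prop :=
| rel0 : rel 0
| rel_lin (a : R) x y : rel x -> rel y -> rel (a *: x + y)
| rel_node Z h z :
    submodule Z -> (forall C, B C -> hom_ext Z C) ->
    (forall (a : R) x y, Z x -> Z y ->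
      rel (comb b (h (a *: x + y)) - (a *: comb b (h x) + comb b (h y)))) ->
    (forall x, Z x -> pi (comb b (h x)) = 0) ->
    Z z -> rel (nu Z h z - comb b (h z)).

Lemma submodule_rel : submodule rel.
Proof. by split; [exact: rel0|exact: rel_lin]. Qed.

Lemma pi_nu Z h x : pi (nu Z h x) = 0.
Proof.
have [s ->] := freeF.1 x; rewrite !linear_comb.
elim: s => [|u s /= ->] //=.
by rewrite nuE pi_node scaler0 addr0.
Qed.

Lemma rel_pi x : rel x -> pi x = 0.
Proof.
elim=> {x} [|a x y _ px _ py|Z h z _ _ _ _ pih Zz]; first exact: linear0.
  by rewrite linearP px py scaler0 addr0.
by rewrite linearB pi_nu pih // subrr.
Qed.

Section Evaluation.
Variables (C : lmodType R) (f : L -> C).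
Hypothesis BC : B C.
Hypothesis flin : linear_on rel f.

Let extends Z h (w : F -> C) (g : {linear F -> C}) :=
  forall z, Z z -> g z = f (nu Z h z - comb b (h z)) + w z.

(** Here [w z] is the value already given to the word [h z]. The default 0 serves nodes whose
    prescribed map does not extend; nodes with relations are shown not to be of this kind. *)
Definition node_value Z h (w : F -> C) (k : K) : C :=
  if pselect (exists g, extends Z h w g) is left e then sval (cid e) (d k)
  else 0.

Fixpoint tree_value (g : G) : C :=
  match g with
  | Base _ => 0
  | Node Z h k => node_value Z h (fun z => comb tree_value (h z)) k
  end.

(** Generators get their values by recursion on trees, and agreement with [f] follows by induction
    on [rel]. At a node, [h] is linear only modulo [rel], where [g = f] by induction. Hence the
    defects of [f (D z)] and [w z] cancel, and their sum is a linear map on [Z] that extends. *)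
Lemma rel_extension : exists g : {linear L -> C}, forall x, rel x -> g x = f x.
Proof.
have [g gE] := freeL.2 C tree_value.
have gcomb s : g (comb b s) = comb tree_value s.
  by rewrite linear_comb; exact: eq_comb.
exists g => x; elim=> {x} [|a x y rx gx ry gy|Z h z hZ good hrel IH pih Zz].
- by rewrite linear0 (linear_on0 submodule_rel flin).
- by rewrite linearP flin // gx gy.
pose w z := comb tree_value (h z).
pose D x := nu Z h x - comb b (h x).
have Drel x : Z x -> rel (D x) by move=> Zx; exact: rel_node.
have [u uE] : exists u, extends Z h w u.
  apply: (good C BC (fun z => f (D z) + w z)) => a x y Zx Zy.
  rewrite /w -!gcomb.
  have DE : D (a *: x + y) = a *: D x + D y
      - (comb b (h (a *: x + y)) - (a *: comb b (h x) + comb b (h y))).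
    by rewrite /D linearP scalerBr addrACA -opprD opprB subrKA.
  rewrite DE (linear_onB flin) ?flin //; try exact: Drel; try exact: hrel.
    rewrite -IH // linearB linearP scalerDr.
    by rewrite opprB addrA subrK addrACA.
  by apply: rel_lin; exact: Drel.
have ex : exists u, extends Z h w u by exists u.
have nuval x : g (nu Z h x) = sval (cid ex) x.
  apply: (is_free_eq (f := g \o nu Z h) freeF) => k /=.
  rewrite nuE gE /= /node_value -/w; case: pselect => // e.
  by rewrite (Prop_irrelevance e ex).
rewrite linearB nuval (svalP (cid ex) z Zz) gcomb.
by rewrite addrK.
Qed.

End Evaluation.

(** [P] is [L] modulo [rel] and [E] is the kernel of [P -> M]. Given [f : Z -> E], words [h z]
    representing [i (f z)] are linear modulo [rel], so [Node Z h] carries its relations and its copy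
    of [F] extends [f]. *)
Lemma precover_exists : exists (E P : lmodType R)
    (i : {linear E -> P}) (p : {linear P -> M}),
  [/\ short_exact i p, forall C, B C -> Ext1_eq0 P C
    & forall Z : set F, submodule Z -> (forall C, B C -> hom_ext Z C) ->
        hom_ext Z E].
Proof.
have [P [y [ysurj y0]]] := quotient_exists submodule_rel.
have [p pE] : exists p : {linear P -> M}, forall x, p (y x) = pi x.
  by apply: factor => // x /y0; exact: rel_pi.
have [E [i [iinj iim]]] := submodule_exists (submodule_ker p).
exists E, P, i, p; split.
- split=> // m; exists (y (b (Base _ _ _ m))).
  by rewrite pE pi_base.
- move=> C BC; apply: (free_hom_ext_Ext1_eq0 freeL ysurj) => f flin.
  have flin' : linear_on rel f by move=> a x x' /y0 ? /y0 ?; exact: flin.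
  have [g gE] := rel_extension BC flin'.
  by exists g => x /y0; exact: gE.
- move=> Z hZ good f flin.
  have /choice[h hE] z : exists s, y (comb b s) = i (f z).
    have [x <-] := ysurj (i (f z)); have [s ->] := freeL.1 x.
    by exists s.
  have node z : Z z -> y (nu Z h z) = i (f z).
    move=> Zz; rewrite -hE; apply/subr0_eq; rewrite -linearB; apply/y0.
    apply: rel_node => //.
      move=> a x x' Zx Zx'; apply/y0.
      by rewrite linearB linearP !hE flin // linearP subrr.
    by move=> x Zx; rewrite -pE hE; apply/iim; exists (f x).
  have /choice[e eE] k : exists e, i e = y (b (Node Z h k)).
    by apply/iim; rewrite /= pE pi_node.
  have [g gE] := freeF.2 E e.
  exists g => z Zz; apply: iinj; rewrite -node //.
  apply: (is_free_eq (f := i \o g) (g := y \o nu Z h) freeF) => k /=.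
  by rewrite gE eE nuE.
Qed.

End Precover.

Lemma approximation_exists (R : pzRingType) (K : Type) (F : lmodType R)
    (d : K -> F) (B : module_class R) (M : lmodType R) :
  is_free d -> exists (E P : lmodType R)
    (i : {linear E -> P}) (p : {linear P -> M}),
  [/\ short_exact i p, forall C, B C -> Ext1_eq0 P C
    & forall Z : set F, submodule Z -> (forall C, B C -> hom_ext Z C) ->
        hom_ext Z E].
Proof.
move=> freeF.
have [L [b freeL]] := free_exists R (tree R M F K).
have /choice[nu nuE] (Zh : set F * (F -> seq (R * tree R M F K))) :
    exists g : {linear F -> L}, forall k, g (d k) = b (Node Zh.1 Zh.2 k).
  exact: freeF.2.
have [pi piE] := freeL.2 M (fun g => if g is Base m then m else 0).
apply: (@precover_exists R K F d freeF B M L b freeL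
  (fun Z h => nu (Z, h)) _ pi).
- by move=> Z h k; rewrite nuE.
- by move=> m; rewrite piE.
- by move=> Z h k; rewrite piE.
Qed.

(** * The filtration argument *)

Section Quotients.
Variables (R : pzRingType) (A : module_class R).
Implicit Types V W : lmodType R.

Definition quotient_in V (Z : set V) :=
  exists W (q : {linear V -> W}),
    [/\ forall w, exists x, q x = w, forall x, q x = 0 <-> Z x & A W].

(** [V] modulo the union of [D] is the direct limit of the quotients [V / Z], indexed by [D] under
    inclusion. *)
Lemma directed_union_quotient V W (q : {linear V -> W}) (D : set (set V)) :
  closed_under_direct_limits A ->
  D !=set0 ->
  (forall Z Z', D Z -> D Z' -> exists2 Z'', D Z'' & Z `|` Z' `<=` Z'') ->
  (forall Z, D Z -> quotient_in Z) ->
  (forall w, exists x, q x = w) ->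
  (forall x, q x = 0 <-> exists2 Z, D Z & Z x) -> A W.
Proof.
move=> hlim [Z0 DZ0] Ddir DA qsurj qker.
pose I := {Z | D Z}.
pose le (i j : I) := sval i `<=` sval j.
have /choice[m mP] (i : I) := DA _ (svalP i).
pose r i := sval (cid (mP i)).
have rP i : [/\ forall w, exists x, r i x = w, forall x, r i x = 0 <-> sval i x
    & A (m i)] by exact: svalP (cid (mP i)).
have rsurj i w : exists x, r i x = w by have [] := rP i.
have rker i x : r i x = 0 <-> sval i x by have [] := rP i.
have tr i j (h : le i j) : exists g : {linear m i -> m j},
    forall x, g (r i x) = r j x.
  by apply: factor => // x /rker /h /rker.
pose t i j h := sval (cid (@tr i j h)).
have tP i j h x : t i j h (r i x) = r j x by exact: (svalP (cid (tr i j h))).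
unshelve epose (S := @DirectedSystem R I le _ _ _ _ _ m t _ _).
- by move=> i x.
- by move=> [Z DZ] [Z' DZ'] ZZ' Z'Z; apply: eq_exist; exact/seteqP.
- by move=> i j k ij jk; apply: subset_trans ij jk.
- by exists (exist _ Z0 DZ0).
- move=> [Z DZ] [Z' DZ']; have [Z'' DZ'' h] := Ddir _ _ DZ DZ'.
  exists (exist _ Z'' DZ''); split=> x /= hx; apply: h; by [left|right].
- by move=> i h x; have [y <-] := rsurj i x; rewrite tP.
- by move=> i j k h h' h'' x; have [y <-] := rsurj i x; rewrite !tP.
have ex_u i : exists u : {linear m i -> W}, forall x, u (r i x) = q x.
  apply: factor => // x /rker ix; apply/qker; exists (sval i) => //.
  exact: svalP.
pose u i := sval (cid (ex_u i)).
have uE i x : u i (r i x) = q x by exact: (svalP (cid (ex_u i))).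
apply: (hlim S W u) => [i|]; first by have [] := rP i.
split=> [i j h x|N v vcone].
  by have [y <-] := rsurj i x; rewrite /= tP !uE.
pose i0 : I := exist _ Z0 DZ0.
have vr (i j : I) x : v i (r i x) = v j (r j x).
  have [Z DZ hZ] := Ddir _ _ (svalP i) (svalP j).
  pose k : I := exist _ Z DZ.
  have ik : le i k by move=> y hy; apply: hZ; left.
  have jk : le j k by move=> y hy; apply: hZ; right.
  by rewrite -(vcone i k ik) -(vcone j k jk) /= !tP.
have [g gE] : exists g : {linear W -> N}, forall x, g (q x) = (v i0 \o r i0) x.
  apply: factor => // x /qker[Z DZ Zx] /=.
  pose k : I := exist _ Z DZ.
  by rewrite (vr _ k); have /rker -> : sval k x by []; rewrite linear0.
exists g; split=> [i x|g' g'E w].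
  by have [y <-] := rsurj i x; rewrite uE gE /= (vr _ i).
by have [x <-] := qsurj w; rewrite gE /= -(uE i0) g'E.
Qed.

End Quotients.

(** * A criterion for membership in the right perpendicular class *)

Section RightPerp.
Variables (R : pzRingType) (A : module_class R).
Hypothesis hlim : closed_under_direct_limits A.
Variables (K : Type) (F : lmodType R) (d : K -> F).
Hypothesis freeF : is_free d.
Variables (E : lmodType R) (good : set F -> Prop).
Hypothesis hE : forall Z, submodule Z -> good Z -> hom_ext Z E.
Hypothesis decomp : forall V : lmodType R, A V -> (exists v : V, v != 0) ->
  exists g : {linear F -> V},
    [/\ exists x, g x != 0, good [set x | g x = 0]
      & quotient_in A (range g)].

Section Step.
Variables (Y X : lmodType R) (i : {linear E -> Y}) (o : {linear Y -> X}).
Hypothesis exE : short_exact i o.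

(* [T] is the image of a section of [o] over a submodule [X'] of [X], with
   [X / X'] in [A]. *)
Definition partial_section (T : set Y) :=
  [/\ submodule T, forall y, T y -> o y = 0 -> y = 0
    & quotient_in A [set y | exists2 t, T t & exists e, y = t + i e]].

Lemma oi0 e : o (i e) = 0.
Proof. by case: exE => _ oker _; apply/oker; exists e. Qed.

Lemma partial_section0 : A X -> partial_section [set 0].
Proof.
have [iinj oker osurj] := exE => AX; split=> [|y //|].
  by split=> // a x y -> ->; rewrite scaler0 addr0.
exists X, o; split=> // y; split=> [/oker[e <-]|[t -> [e ->]]].
  by exists 0 => //; exists e; rewrite add0r.
by rewrite add0r oi0.
Qed.

(** Lift [g : F -> W] to [g' : F -> Y]. On the kernel [Z] of [g], [g'] lands in [T + i E], and its
    component in [E] extends to [f : F -> E]. Then [h = g' - i f] sends [Z] into [T], and adjoining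
    its range to [T] leaves the quotient [W / range g]. *)
Lemma partial_section_step (T : set Y) (W : lmodType R) (q : {linear Y -> W}) :
  partial_section T -> (forall w, exists x, q x = w) ->
  (forall y, q y = 0 <-> exists2 t, T t & exists e, y = t + i e) ->
  A W -> (exists w : W, w != 0) ->
  exists2 T', T `<` T' & partial_section T'.
Proof.
move=> [hT To _] qsurj qker AW W0.
have [g [[x0 gx0] goodg [W' [r [rsurj rker AW']]]]] := decomp AW W0.
have [iinj oker osurj] := exE.
have [g' g'E] := free_lift g freeF qsurj.
have qT t : T t -> q t = 0.
  by move=> Tt; apply/qker; exists t => //; exists 0; rewrite linear0 addr0.
have qi e : q (i e) = 0.
  by apply/qker; exists 0; [exact: submodule0|exists e; rewrite add0r].
pose Z := [set x | g x = 0].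
have /choice[e eE] z : exists e, Z z -> T (g' z - i e).
  have [Zz|nZz] := pselect (Z z); last by exists 0.
  have /qker[t Tt [e he]] : q (g' z) = 0 by rewrite g'E.
  by exists e => _; rewrite he addrK.
have hZ : submodule Z by exact: submodule_ker.
have elin : linear_on Z e.
  move=> a x y Zx Zy; apply: iinj.
  have Zxy : Z (a *: x + y) by exact: hZ.2.
  (* The defect of linearity of [e] lies in [T] and in the kernel of [o], which meet in 0. *)
  have : T (i (e (a *: x + y) - (a *: e x + e y))).
    have -> : i (e (a *: x + y) - (a *: e x + e y)) =
        (a *: (g' x - i (e x)) + (g' y - i (e y)))
        - (g' (a *: x + y) - i (e (a *: x + y))).
      rewrite linearB [i (_ + _)]linearP [g' (_ + _)]linearP.
      by rewrite scalerBr addrACA -opprD opprB [RHS]addrC subrKA.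
    by apply: submoduleB => //; [apply: hT.2|]; exact: eE.
  by move=> /To /(_ (oi0 _)) /eqP; rewrite linearB subr_eq0 => /eqP.
have [f fE] := hE hZ goodg elin.
have hlin : linear (fun x => g' x - i (f x)).
  move=> a x y; rewrite [g' _]linearP [f _]linearP [i _]linearP.
  by rewrite scalerBr opprD addrACA.
have [h hE'] := bundle_linear hlin.
have qh x : q (h x) = g x by rewrite hE' linearB g'E qi subr0.
have Th x : g x = 0 -> T (h x).
  by move=> gx; rewrite hE' fE //; exact: eE.
pose T' := [set y | exists2 t, T t & exists x, y = t + h x].
exists T'.
  split=> [y Ty|TT'].
    by exists y => //; exists 0; rewrite linear0 addr0.
  have /TT' : T' (h x0).
    by exists 0; [exact: submodule0|exists x0; rewrite add0r].
  by move=> /qT; rewrite qh => /eqP; rewrite (negbTE gx0).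
split.
- split; first by exists 0; [exact: submodule0|exists 0; rewrite linear0 addr0].
  move=> a _ _ [t Tt [x ->]] [t' Tt' [x' ->]].
  exists (a *: t + t'); first exact: hT.2.
  by exists (a *: x + x'); rewrite linearP scalerDr addrACA.
- move=> _ [t Tt [x ->]] /[dup] oy /oker[e1 e1E]; apply: To => //.
  apply: submoduleD => //; apply: Th.
  by rewrite -qh -[h x](addKr t) addrC -e1E linearB qi (qT t) // subrr.
- exists W', (r \o q); split=> [w|y|//].
    by have [v <-] := rsurj w; have [y <-] := qsurj v; exists y.
  split=> [/rker[x _ gx]|[_ [t Tt [x ->]] [e1 ->]] /=].
    have /qker[t Tt [e1 yE]] : q (y - h x) = 0 by rewrite linearB qh gx subrr.
    exists (t + h x); first by exists t => //; exists x.
    by exists e1; rewrite addrAC -yE subrK.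
  have -> : q (t + h x + i e1) = g x.
    by rewrite !linearD qi addr0 (qT t) // add0r qh.
  by apply/rker; exists x.
Qed.

(** The submodules [T + i E] form a chain with union [ker (\bigcup_(T in S) T)]; the quotient by it
    is in [A] by closure under direct limits. *)
Lemma partial_section_chain (S : set (set Y)) :
  S !=set0 -> (forall T, S T -> partial_section T) -> total_on S subset ->
  partial_section (\bigcup_(T in S) T).
Proof.
move=> [T0 ST0] Ssec Stot.
have [hT0 _ _] := Ssec _ ST0.
have hU : submodule (\bigcup_(T in S) T).
  split=> [|a x y [T ST Tx] [T' ST' T'y]].
    by exists T0 => //; exact: submodule0.
  have [TT'|T'T] := Stot _ _ ST ST'.
    exists T' => //; have [hT' _ _] := Ssec _ ST'.
    by apply: hT'.2 => //; exact: TT'.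
  exists T => //; have [hT _ _] := Ssec _ ST.
  by apply: hT.2 => //; exact: T'T.
pose ker T := [set y | exists2 t, T t & exists e, y = t + i e].
have kerS T T' : T `<=` T' -> ker T `<=` ker T'.
  by move=> TT' y [t /TT' Tt h]; exists t.
have hk : submodule (ker (\bigcup_(T in S) T)).
  split; first by exists 0; [exact: submodule0|exists 0; rewrite linear0 addr0].
  move=> a _ _ [t Tt [e ->]] [t' Tt' [e' ->]].
  exists (a *: t + t'); first exact: hU.2.
  by exists (a *: e + e'); rewrite linearP scalerDr addrACA.
split=> [//|y [T ST Ty] oy|].
  by have [_ To _] := Ssec _ ST; exact: To.
have [W [q [qsurj qker]]] := quotient_exists hk.
exists W, q; split=> //.
pose D := [set ker T | T in S].
apply: (directed_union_quotient (q := q) (D := D) hlim) => //.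
- by exists (ker T0), T0.
- move=> _ _ [T ST <-] [T' ST' <-].
  have [TT'|T'T] := Stot _ _ ST ST'.
    by exists (ker T'); [exists T'|move=> y []; [exact: kerS|]].
  by exists (ker T); [exists T|move=> y []; [|exact: kerS]].
- by move=> _ [T ST <-]; have [] := Ssec _ ST.
- move=> x; rewrite qker; split=> [[t [T ST Tt] he]|[_ [T ST <-] [t Tt he]]].
    by exists (ker T); [exists T|exists t].
  by exists t => //; exists T.
Qed.

Lemma retraction_exists : A X ->
  exists r : {linear Y -> E}, forall e, r (i e) = e.
Proof.
move=> AX; have [iinj oker osurj] := exE.
have [T [Tsec Tmax]] :
    exists T, partial_section T /\ forall T', T `<` T' -> ~ partial_section T'.
  have [|T [[T0|Tsec] Tmax]] :=
      @Zorn_bigcup Y (fun T => T = set0 \/ partial_section T).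
  - move=> S SP Stot.
    have [[T [ST Tsec]]|noT] := pselect (exists T, S T /\ partial_section T).
      right; pose S' := S `&` partial_section.
      have -> : \bigcup_(T in S) T = \bigcup_(T in S') T.
        apply/seteqP; split=> y [T' ST' T'y].
          exists T' => //; split=> //.
          by have [T'0|//] := SP _ ST'; move: T'y; rewrite T'0.
        by exists T' => //; case: ST'.
      apply: partial_section_chain.
      + by exists T.
      + by move=> T' [].
      + by move=> T1 T2 [ST1 _] [ST2 _]; exact: Stot.
    left; rewrite -subset0 => y [T ST Ty].
    by have [T0|Tsec] := SP _ ST; [rewrite T0 in Ty|apply: noT; exists T].
  - rewrite T0 in Tmax; have /Tmax[] : set0 `<` [set (0 : Y)].
      by split=> // /(_ 0); exact.
    by right; exact: partial_section0.
  - by exists T; split=> // T' TT' T'sec; apply: (Tmax _ TT'); right.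
have [hT To [W [q [qsurj qker AW]]]] := Tsec.
(* Maximality forces [T + i E = Y]; the retraction is the projection along [T]. *)
have q0 y : q y = 0.
  have [//|/eqP qy] := pselect (q y = 0).
  have [|T' /Tmax + T'sec] := partial_section_step Tsec qsurj qker AW.
    by exists (q y).
  by move=> /(_ T'sec).
have /choice[r rE] y : exists e, T (y - i e).
  by have /qker[t Tt [e ->]] := q0 y; exists e; rewrite addrK.
have uniq y e : T (y - i e) -> r y = e.
  move=> Te; apply: iinj; apply/eqP; rewrite -subr_eq0; apply/eqP.
  apply: To; last by rewrite -linearB oi0.
  have -> : i (r y) - i e = (y - i e) - (y - i (r y)).
    by rewrite opprB [RHS]addrC subrKA.
  by apply: submoduleB.
have rlin : linear r.
  move=> a x y; apply: uniq.
  rewrite linearP opprD addrACA -scalerBr.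
  by apply: hT.2; exact: rE.
have [r' r'E] := bundle_linear rlin.
by exists r' => e; rewrite r'E; apply: uniq; rewrite subrr; exact: submodule0.
Qed.

End Step.

Lemma right_perp_of_decomposition : right_perp A E.
Proof.
move=> X AX; apply/Ext1_eq0P => Ex.
exact: (retraction_exists (ext_exact Ex) AX).
Qed.

End RightPerp.

(** * Cardinals and normal measures *)

Section Cardinals.
Implicit Types T U : Type.

Lemma card_leTP T U (D : set U) :
  [set: T] #<= D <-> exists f : T -> U, injective f /\ forall t, D (f t).
Proof.
split=> [/card_leP[f]|[f [finj fD]]].
  pose g t := f (SigSub (mem_set (I : [set: T] t))).
  exists (fun t => val (g t)); split=> [t t' /val_inj|t].
    move=> h; suff : SigSub (mem_set (I : [set: T] t)) =
        SigSub (mem_set (I : [set: T] t')) by move=> [].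
    by apply: (@inj _ _ setT f); rewrite ?inE.
  by apply: set_mem; exact: valP.
have fS : set_fun [set: T] D f by move=> t _; exact: fD.
have fI : set_inj [set: T] f by move=> t t' _ _; exact: finj.
have /injfunPex[g] : exists2 g : T -> U, set_fun [set: T] D g & set_inj setT g.
  by exists f.
exact: inj_card_le.
Qed.

(** A maximal graph of a partial injection is total on one side, as otherwise a pair [(t, u)] of
    unmatched elements could be added. *)
Lemma card_le_total T U :
  [set: T] #<= [set: U] \/ [set: U] #<= [set: T].
Proof.
have [S SP|G [GP Gmax]] :=
    @Zorn_bigcup (T * U) (fun G => forall u v, G u -> G v ->
      u.1 = v.1 <-> u.2 = v.2).
  move=> Stot u v [G SG Gu] [H SH Hv].
  by have [GH|HG] := Stot _ _ SG SH; [apply: (SP _ SH)|apply: (SP _ SG)] => //;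
    [exact: GH|exact: HG].
have [totG|] := pselect (forall t, exists u, G (t, u)).
  have [f fG] := choice totG; left; apply/card_leTP; exists f; split=> // t t'.
  by move/(GP _ _ (fG t) (fG t')).
move/existsNP => [t tG].
have [surG|] := pselect (forall u, exists t, G (t, u)).
  have [f fG] := choice surG; right; apply/card_leTP; exists f; split=> // u u'.
  by move/(GP _ _ (fG u) (fG u')).
move/existsNP => [u uG].
have /Gmax[] : G `<` G `|` [set (t, u)].
  split=> [v|/(_ (t, u))]; first by left.
  by move=> h; apply: tG; exists u; apply: h; right.
move=> [t1 u1] [t2 u2] [G1|[-> ->]] [G2|[-> ->]] //=.
- exact: GP G1 G2.
- by split=> h; subst; [case: tG; exists u1|case: uG; exists t1].
- by split=> h; subst; [case: tG; exists u2|case: uG; exists t2].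
Qed.

Lemma enumeration T U (D : set U) : ~ ([set: T] #<= D) -> D !=set0 ->
  exists f : T -> U, range f = D.
Proof.
move=> TD [u0 Du0]; have [/card_leTP[f [finj _]]|] := card_le_total T {u | D u}.
  case: TD; apply/card_leTP; exists (fun t => sval (f t)).
  split=> [t t'|t]; last exact: svalP.
  case: (f t) (f t') (@finj t t') => [x Dx] [y Dy] /= h xy.
  by apply: h; exact: eq_exist.
move=> /card_leTP[g [ginj _]].
have /choice[f fP] t : exists u, D u /\ forall x, g x = t -> u = sval x.
  have [[x gx]|nx] := pselect (exists x, g x = t).
    exists (sval x); split=> [|y gy]; first exact: svalP.
    by congr sval; apply: ginj; rewrite gx gy.
  by exists u0; split=> // x gx; case: nx; exists x.
exists f; apply/seteqP; split=> [_ [t _ <-]|u Du]; first by case: (fP t).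
set x := exist _ u Du : {u | D u}; exists (g x) => //.
by have [_ /(_ x erefl)] := fP (g x).
Qed.

(** If every cardinal in [P] were at most [J], the subsets of [J] would form a set representing all
    of them. *)
Lemma proper_class_unbounded (P : small -> Prop) (J : small) :
  proper_class_of_cardinals P -> exists2 K, P K & ~ ([set: K] #<= [set: J]).
Proof.
move=> hP; apply: contrapT => hJ; apply: hP.
exists (set J), (fun D => {x | D x}) => K PK.
have /card_leTP[f [finj _]] : [set: K] #<= [set: J].
  by apply: contrapT => KJ; apply: hJ; exists K.
have ranf k : range f (f k) by exists k.
exists (range f); rewrite card_eqPle; split; apply/card_leTP.
  exists (fun k => exist _ (f k) (ranf k)); split=> // k k' /(congr1 sval) /=.
  exact: finj.
have /choice[g gE] (x : {x | range f x}) : exists k, f k = sval x.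
  by have [k _ fk] := svalP x; exists k.
exists g; split=> // -[x Dx] [y Dy] /(congr1 f); rewrite !gE /=.
exact: eq_exist.
Qed.

End Cardinals.

(** * Consequences of normality and completeness *)

Section NormalMeasure.
Variables (K X : small) (U : set_system (P_below K X)).
Hypothesis nU : normal_measure U.

#[local] Instance ultraU : UltraFilter U := measure_ultra nU.

Lemma measure_dichotomy D : U D \/ U (~` D).
Proof. exact: in_ultra_setVsetC. Qed.

Lemma measureS D D' : U D -> D `<=` D' -> U D'.
Proof. by move=> UD DD'; exact: filterS DD' UD. Qed.

Lemma measureI D D' : U D -> U D' -> U (D `&` D').
Proof. exact: filterI. Qed.

Lemma measure_inh D : U D -> exists p, D p.
Proof. exact: filter_ex. Qed.

(** Otherwise choosing a counterexample in almost every [p] is regressive, hence constantly some [x]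
    on a set in [U], which contradicts [U (D x)]. *)
Lemma diagonal_intersection (D : X -> set (P_below K X)) :
  (forall x, U (D x)) -> U [set p | forall x, sval p x -> D x p].
Proof.
move=> UD; have [//|Ubad] := measure_dichotomy
  [set p | forall x, sval p x -> D x p].
have bad p : (~` [set p | forall x, sval p x -> D x p]) p ->
    exists x, sval p x /\ ~ D x p.
  by move=> /existsNP[x /not_implyP]; exists x.
have [p0 /bad[x0 _]] := measure_inh Ubad.
have /choice[f fP] p : exists x,
    (~` [set p | forall x, sval p x -> D x p]) p -> sval p x /\ ~ D x p.
  have [/[dup] h /bad[x]|np] :=
      pselect ((~` [set p | forall x, sval p x -> D x p]) p); first by exists x.
  by exists x0 => /np.
have [x Ux] : exists x, U [set p | f p = x].
  by apply: (measure_normal nU); apply: measureS Ubad _ => p /fP[].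
have [p [[/= fx /fP[_ nD]] Dx]] :=
  measure_inh (measureI (measureI Ux Ubad) (UD x)).
by case: nD; rewrite fx.
Qed.

(** Otherwise [U] contains the complements of all fibres and, by completeness, their empty
    intersection. *)
Lemma measure_constant (S : small) (f : P_below K X -> S) :
  ~ ([set: K] #<= [set: S]) -> exists s, U [set p | f p = s].
Proof.
move=> KS; apply: contrapT => nconst.
have [|p hp] := measure_inh (measure_complete nU
    (F := fun s => ~` [set p | f p = s]) KS _).
  move=> s; have [Us|//] := measure_dichotomy [set p | f p = s].
  by case: nconst; exists s.
by have /(_ I) := hp (f p); apply.
Qed.

(* Functions with small range are constant on a set in [U], pointwise in [x];
   normality makes this uniform in [x]. *)
Lemma coherent_function (C : small) (h : P_below K X -> X -> C) :
  ~ ([set: K] #<= [set: C]) ->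
  exists f : X -> C, U [set p | forall x, sval p x -> h p x = f x].
Proof.
move=> KC.
have /choice[f fU] x : exists c, U [set p | h p x = c].
  exact: measure_constant.
exists f; exact: (diagonal_intersection (D := fun x => [set p | h p x = f x])).
Qed.

End NormalMeasure.

(** * Reflection *)

Section Reflection.
Variables (R : pzRingType) (K : small).
Hypothesis KR : ~ ([set: K] #<= [set: R]).

Section Measure.
Variables (X V : lmodType R) (phi : {linear X -> V}).
Variables (T : small) (e : T -> X).
Hypothesis freeX : is_free e.
Variable U : set_system (P_below K X).
Hypothesis nU : normal_measure U.

Let fineU := measure_fine nU.

(** Fineness gives each single closure condition; diagonal intersections make it uniform in [x] and
    [y], and completeness in the scalar, [R] being smaller than [K]. *)
Lemma measure_submodule : U [set p | submodule (sval p)].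
Proof.
have Uclosed : U (\bigcap_a [set p | forall x, sval p x ->
    forall y, sval p y -> sval p (a *: x + y)]).
  apply: (measure_complete nU) => // a.
  apply: (diagonal_intersection nU (D := fun x => [set p |
    forall y, sval p y -> sval p (a *: x + y)])) => x.
  apply: (diagonal_intersection nU (D := fun y => [set p |
    sval p (a *: x + y)])) => y.
  exact: fineU.
apply: (measureS nU (measureI nU (fineU 0) Uclosed)) => p [/= p0 pP].
by split=> // a x y px py; apply: (pP a I).
Qed.

(** Each [x] involves finitely many basis elements, all in almost every [p]. Thus maps can be lifted
    from [p] basis element by basis element, as from a free module. *)
Lemma measure_spanned : U [set p | forall x, sval p x ->
  forall S, submodule S -> (forall t, sval p (e t) -> S (e t)) -> S x].
Proof.
apply: (diagonal_intersection nU (D := fun x => [set p |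
  forall S, submodule S -> (forall t, sval p (e t) -> S (e t)) -> S x])) => x.
have [s ->] := freeX.1 x; elim: s => [|[a t] s IH] /=.
  by apply: (measureS nU (fineU 0)) => p _ S hS _; exact: submodule0.
apply: (measureS nU (measureI nU IH (fineU (e t)))) => p [/= hs pt] S hS Sp.
by apply: hS.2; [exact: Sp|exact: hs].
Qed.

Variable C : lmodType R.
Hypothesis KC : ~ ([set: K] #<= [set: C]).

(** By fineness a single [p] in [bad] contains [x], [y] and [a *: x + y], so one instance of
    linearity of [f] is one of [h p]. *)
Lemma measure_linear (D : set X) (h : P_below K X -> X -> C) (f : X -> C)
    (bad : set (P_below K X)) :
  submodule D -> U [set p | forall x, sval p x -> h p x = f x] -> U bad ->
  (forall p, bad p -> linear_on (sval p `&` D) (h p)) -> linear_on D f.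
Proof.
move=> hD Uf Ubad hlin a x y Dx Dy.
have [p [[hf badp] [px [py pxy]]]] := measure_inh nU (measureI nU
  (measureI nU Uf Ubad) (measureI nU (fineU x) (measureI nU (fineU y)
  (fineU (a *: x + y))))).
by rewrite -!hf //; apply: hlin.
Qed.

Lemma measure_hom_ext_ker : hom_ext [set x | phi x = 0] C ->
  U [set p | hom_ext (sval p `&` [set x | phi x = 0]) C].
Proof.
move=> hker; set good := [set p | _].
have [//|Ubad] := measure_dichotomy nU good.
have /choice[h hP] p : exists h : X -> C, ~ good p ->
    linear_on (sval p `&` [set x | phi x = 0]) h /\
    ~ exists g : {linear X -> C}, forall x,
        (sval p `&` [set x | phi x = 0]) x -> g x = h x.
  have [gp|/existsNP[h /not_implyP hh]] := pselect (good p); last by exists h.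
  by exists (fun=> 0).
have [f Uf] := coherent_function nU h KC.
have flin : linear_on [set x | phi x = 0] f.
  apply: (measure_linear (submodule_ker phi) Uf Ubad) => p badp.
  by have [] := hP p badp.
have [g gE] := hker f flin.
have [p [pf badp]] := measure_inh nU (measureI nU Uf Ubad).
have [_ []] := hP p badp; exists g => x [px phix].
by rewrite gE // -pf.
Qed.

(** Extension of maps from [phi(D)] to [V], written on [X] as maps that kill the kernel of [phi]. *)
Definition image_hom_ext (D : set X) :=
  forall h : X -> C, linear_on D h ->
    (forall x, D x -> phi x = 0 -> h x = 0) ->
  exists g : {linear X -> C},
    (forall x, D x -> g x = h x) /\ (forall x, phi x = 0 -> g x = 0).

(** The coherent map is itself the extension: by fineness it is linear on all of [X] and kills the
    kernel of [phi]. *)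
Lemma measure_image_hom_ext : U [set p | image_hom_ext (sval p)].
Proof.
set good := [set p | _]; have [//|Ubad] := measure_dichotomy nU good.
have /choice[h hP] p : exists h : X -> C, ~ good p ->
    [/\ linear_on (sval p) h, (forall x, sval p x -> phi x = 0 -> h x = 0)
    & ~ exists g : {linear X -> C}, (forall x, sval p x -> g x = h x) /\
        (forall x, phi x = 0 -> g x = 0)].
  have [gp|/existsNP[h /not_implyP[h1 /not_implyP[h2 h3]]]] := pselect (good p).
    by exists (fun=> 0).
  by exists h.
have [f Uf] := coherent_function nU h KC.
have flin : linear_on setT f.
  apply: (measure_linear _ Uf Ubad) => [|p badp]; first by [].
  by have [hlin _ _] := hP p badp => a x y [px _] [py _]; exact: hlin.
have [g gE] : exists g : {linear X -> C}, g =1 f.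
  by apply: bundle_linear => a x y; exact: flin.
have [p [pf badp]] := measure_inh nU (measureI nU Uf Ubad).
have [_ _ []] := hP p badp; exists g; split=> x; first by rewrite gE => /pf.
move=> phix; have [p' [[pf' badp'] px]] :=
  measure_inh nU (measureI nU (measureI nU Uf Ubad) (fineU x)).
have [_ hk _] := hP p' badp'.
by rewrite gE -pf' // hk.
Qed.

End Measure.

Section Decomposition.
Variables (I : small) (F : I -> lmodType R).
Hypothesis KI : ~ ([set: K] #<= [set: I]).
Hypothesis KF : forall i, ~ ([set: K] #<= [set: F i]).

Variables (L : lmodType R) (d : K -> L).
Hypothesis freeL : is_free d.

Section Images.
Variables (X V : lmodType R) (phi : {linear X -> V}).
Variables (T : small) (e : T -> X).
Hypothesis freeX : is_free e.
Variable D : set X.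
Hypothesis hD : submodule D.

(** [Q] is a copy of [phi(D)], hence a quotient of [D] by its part of the kernel of [phi]. Lifts
    from [D] to an extension are prescribed on the basis elements in [D], which span [D]. *)
Lemma Ext1_eq0_image (k : K -> X) (g : {linear L -> V})
    (Q : lmodType R) (pi : {linear L -> Q}) (C : lmodType R) :
  range k = D -> (forall t, g (d t) = phi (k t)) ->
  (forall q, exists x, pi x = q) -> (forall x, pi x = 0 <-> g x = 0) ->
  (forall x, D x ->
    forall S, submodule S -> (forall t, D (e t) -> S (e t)) -> S x) ->
  hom_ext (D `&` [set x | phi x = 0]) C -> Ext1_eq0 Q C.
Proof.
move=> kD gE pisurj piker span ext.
have [P [i [iinj iD]]] := submodule_exists hD.
have /choice[w0 w0E] t : exists s, i s = k t.
  by apply/iD; rewrite -kD; exists t.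
have [w wE] := freeL.2 P w0.
have giw x : g x = phi (i (w x)).
  apply: (is_free_eq (g := phi \o i \o w) freeL) => t /=.
  by rewrite gE wE w0E.
have wsurj s : exists x, w x = s.
  have [t _ kt] : range k (i s) by rewrite kD; apply/iD; exists s.
  by exists (d t); apply: iinj; rewrite wE w0E.
have [sg sgE] : exists sg : {linear P -> Q}, forall x, sg (w x) = pi x.
  by apply: factor => // x wx; apply/piker; rewrite giw wx !linear0.
have sgsurj q : exists s, sg s = q.
  by have [x <-] := pisurj q; exists (w x); rewrite sgE.
have sgker s : sg s = 0 -> phi (i s) = 0.
  by have [x <-] := wsurj s; rewrite sgE -giw => /piker.
apply: (hom_ext_Ext1_eq0 sgsurj) => [E|f flin].
  have [_ _ osurj] := ext_exact E.
  have /choice[G0 G0E] t : exists y, forall s, i s = e t -> ext_out E y = sg s.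
    have [[s se]|ns] := pselect (exists s, i s = e t).
      have [y yE] := osurj (sg s); exists y => s' s'e.
      by rewrite yE; congr (sg _); apply: iinj; rewrite se s'e.
    by exists 0 => s se; case: ns; exists s.
  have [G GE] := freeX.2 _ G0.
  exists (G \o i) => s /=.
  pose S := [set x | exists s, i s = x /\ ext_out E (G x) = sg s].
  have [s' [/iinj <- //]] : S (i s).
    apply: span; first by apply/iD; exists s.
      split; first by exists 0; rewrite !linear0.
      move=> a _ _ [s1 [<- h1]] [s2 [<- h2]].
      by exists (a *: s1 + s2); rewrite !linearP h1 h2.
    move=> t /iD[s' s't]; exists s'; split=> //.
    by rewrite GE; exact: G0E.
have /choice[j jE] x : exists s, D x -> i s = x.
  by have [/iD[s sx]|nD] := pselect (D x); [exists s|exists 0].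
have hlin : linear_on (D `&` [set x | phi x = 0]) (f \o j).
  move=> a x y [Dx phix] [Dy phiy] /=.
  have jP : j (a *: x + y) = a *: j x + j y.
    apply: iinj; rewrite [RHS]linearP !jE //; exact: hD.2.
  have ker z : D z -> phi z = 0 -> sg (j z) = 0.
    move=> Dz phiz; have [y' yE] := wsurj (j z).
    by rewrite -yE sgE; apply/piker; rewrite giw yE jE.
  by rewrite jP flin //=; exact: ker.
have [h hE] := ext _ hlin.
exists (h \o i) => s sgs /=.
have Ds : D (i s) by apply/iD; exists s.
rewrite hE /=; last by split=> //; exact: sgker.
by congr f; apply: iinj; rewrite jE.
Qed.

(** [W] is [X] modulo [ker phi + D]. A map [f] on this sum is first extended from [ker phi] to [f1],
    using Ext^1(V, C) = 0; then [f - f1] on [D] extends to [f2] vanishing on [ker phi], and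
    [f1 + f2] extends [f]. *)
Lemma Ext1_eq0_coimage (W : lmodType R) (r : {linear V -> W}) (C : lmodType R) :
  (forall v, exists x, phi x = v) -> (forall w, exists v, r v = w) ->
  (forall v, r v = 0 <-> exists2 x, D x & phi x = v) ->
  Ext1_eq0 V C -> image_hom_ext phi C D -> Ext1_eq0 W C.
Proof.
move=> phisurj rsurj rker VC ext.
apply: (free_hom_ext_Ext1_eq0 (p := r \o phi) freeX) => [w|f flin].
  by have [v <-] := rsurj w; have [x <-] := phisurj v; exists x.
have DN x : D x -> r (phi x) = 0 by move=> Dx; apply/rker; exists x.
have kN x : phi x = 0 -> r (phi x) = 0 by move=> ->; exact: linear0.
have [f1 f1E] : exists g : {linear X -> C}, forall x, phi x = 0 -> g x = f x.
  apply: (Ext1_eq0_hom_ext phisurj VC) => a x y /kN ? /kN ?; exact: flin.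
have [||f2 [f2E f2k]] := ext (fun x => f x - f1 x).
- move=> a x y /DN Dx /DN Dy; rewrite flin // linearP.
  by rewrite scalerBr opprD addrACA.
- by move=> x _ phix; rewrite f1E // subrr.
have glin : linear (fun x => f1 x + f2 x).
  by move=> a x y; rewrite !linearP scalerDr addrACA.
have [g gE] := bundle_linear glin.
exists g => x /= /rker[y Dy yx].
pose z := x - y; have -> : x = z + y by rewrite subrK.
have phiz : phi z = 0 by rewrite linearB yx subrr.
rewrite gE (linearD f1) (linearD f2) f2k // add0r f2E // f1E //.
rewrite -addrA [f1 y + _]addrC subrK -[z]scale1r flin ?scale1r //=.
- exact: kN.
- exact: DN.
Qed.

End Images.

Lemma reflecting_submodule (X V : lmodType R) (phi : {linear X -> V})
    (T : small) (e : T -> X) (x0 : X) :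
  supercompact K -> [set: K] #<= [set: X] -> is_free e ->
  (forall v, exists x, phi x = v) -> (forall i, Ext1_eq0 V (F i)) ->
  exists D : set X,
    [/\ submodule D, D x0 & ~ ([set: K] #<= D)] /\
    [/\ forall x, D x ->
          forall S, submodule S -> (forall t, D (e t) -> S (e t)) -> S x,
        forall i, hom_ext (D `&` [set x | phi x = 0]) (F i)
      & forall i, image_hom_ext phi (F i) D].
Proof.
move=> [_ /[apply] -[U nU]] freeX phisurj VF.
have Uker : U (\bigcap_i
    [set p | hom_ext (sval p `&` [set x | phi x = 0]) (F i)]).
  apply: (measure_complete nU) => // i; apply: (measure_hom_ext_ker nU) => //.
  exact: Ext1_eq0_hom_ext.
have Uim : U (\bigcap_i [set p | image_hom_ext phi (F i) (sval p)]).
  by apply: (measure_complete nU) => // i; exact: (measure_image_hom_ext _ nU).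
have [p [[[psub pspan] px] [pker pim]]] := measure_inh nU (measureI nU
  (measureI nU (measureI nU (measure_submodule nU) (measure_spanned freeX nU))
    (measure_fine nU x0)) (measureI nU Uker Uim)).
exists (sval p); split; split=> //; first exact: (svalP p).
- by move=> i; exact: pker.
- by move=> i; exact: pim.
Qed.

Variables (A B : module_class R).
Hypothesis AF : forall M, A M <-> forall i, Ext1_eq0 M (F i).
Hypothesis AB : forall M C, A M -> B C -> Ext1_eq0 M C.

(** The small submodule appears as the image of the fixed free module [L] on [K], so that the
    kernels arising from all [V] are submodules of one module and form a set. *)
Lemma decomposition (V : lmodType R) :
  supercompact K -> A V -> (exists v : V, v != 0) ->
  exists g : {linear L -> V},
    [/\ exists x, g x != 0,
        forall C, B C -> hom_ext [set x | g x = 0] C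
      & quotient_in A (range g)].
Proof.
move=> scK AV [v v0].
have [k0 _] : exists k0 : K, True.
  apply: contrapT => Kempty; apply: KR; apply/card_leTP.
  by exists (fun=> 0); split=> // k; case: Kempty; exists k.
(* The factor [K] makes [X] large enough for supercompactness to apply. *)
have [X [e freeX]] := free_exists R (V * K).
have [phi phiE] := freeX.2 V fst.
have phisurj u : exists x, phi x = u by exists (e (u, k0)); rewrite phiE.
have KX : [set: K] #<= [set: X].
  apply/card_leTP; exists (fun k => e (v, k)); split=> // k k' ekk'.
  have [f fE] := freeX.2 V (fun t => if `[< t.2 = k >] then v else 0).
  have := congr1 f ekk'; rewrite !fE /= asboolT //.
  by case: asboolP => // _ v0'; rewrite v0' eqxx in v0.
have VF : forall i, Ext1_eq0 V (F i) by apply/AF.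
have [D [[hD Dv KD] [span extker extim]]] :=
  reflecting_submodule (e (v, k0)) scK KX freeX phisurj VF.
(* As [D] is smaller than [K], the basis of [L] can enumerate it, and [g] then has range
   [phi(D)]. *)
have [k kD] := enumeration KD (ex_intro _ _ Dv).
have [g gE] := freeL.2 V (phi \o k).
have [gX gXE] := freeL.2 X k.
have ggX x : g x = phi (gX x).
  by apply: (is_free_eq (g := phi \o gX) freeL) => t /=; rewrite gE gXE.
have DgX x : D (gX x).
  have [s ->] := freeL.1 x; rewrite linear_comb.
  elim: s => [|u s IH] /=; first exact: submodule0.
  by apply: hD.2 => //; rewrite gXE -kD; exists u.2.
have rg u : range g u <-> exists2 x, D x & phi x = u.
  split=> [[x _ <-]|[x]]; first by exists (gX x).
  by rewrite -kD => -[t _ <-] <-; exists (d t); rewrite ?gE.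
exists g; split.
- have [t _ kt] : range k (e (v, k0)) by rewrite kD.
  by exists (d t); rewrite gE /= kt phiE.
- have [Q [pi [pisurj piker]]] := quotient_exists (submodule_ker g).
  have AQ : A Q.
    apply/AF => i.
    exact: (Ext1_eq0_image freeX hD kD gE pisurj piker span (extker i)).
  move=> C BC f flin.
  have [|h hE] := Ext1_eq0_hom_ext pisurj (AB AQ BC) (f := f).
    by move=> a x y /piker ? /piker ?; exact: flin.
  by exists h => x /piker; exact: hE.
- have hrg : submodule (range g).
    split; first by exists 0; rewrite ?linear0.
    by move=> a _ _ [x _ <-] [y _ <-]; exists (a *: x + y); rewrite ?linearP.
  have [W [r [rsurj rker]]] := quotient_exists hrg.
  exists W, r; split=> //; apply/AF => i.
  apply: (Ext1_eq0_coimage freeX (D := D) phisurj rsurj) => // u.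
  by rewrite rker.
Qed.

End Decomposition.
End Reflection.

Theorem corollary1p7 (hSC : proper_class_of_cardinals supercompact)
    (R : pzRingType) (A B : module_class R)
    (hcot : cotorsion_pair A B)
    (hcog : cogenerated_by_set A B)
    (hlim : closed_under_direct_limits A) :
  complete_pair A B.
Proof.
move=> M; have [AB BA] := hcot; have [I [F [AF _]]] := hcog.
have AF' N : A N <-> forall i, Ext1_eq0 N (F i).
  split=> [/AF NF i|NF]; first by apply: NF; exists i.
  by apply/AF => _ [i <-]; exact: NF.
(* One bound for [R], [I] and every [F i]: each of them injects into [J]. *)
pose J : small := (R + I + {i : I & F i})%type.
have [K scK KJ] := proper_class_unbounded J hSC.
have below (S : small) (f : S -> J) : injective f -> ~ ([set: K] #<= [set: S]).
  move=> finj /card_leTP[g [ginj _]]; apply: KJ; apply/card_leTP.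
  by exists (f \o g); split=> //; exact: inj_comp.
have KR : ~ ([set: K] #<= [set: R]) by apply: (below _ (inl \o inl)) => x y [].
have KI : ~ ([set: K] #<= [set: I]) by apply: (below _ (inl \o inr)) => x y [].
have KF i : ~ ([set: K] #<= [set: F i]).
  apply: (below _ (fun x => inr (existT _ i x))) => x y [] xy.
  by have := projT2_eq xy; rewrite (Prop_irrelevance (projT1_eq xy) erefl).
have [L [d freeL]] := free_exists R K.
have [N [P [i [p [ip PB extN]]]]] := approximation_exists B M freeL.
exists N, P, i, p; split=> //; last exact/AB.
(* The predicate [good] becomes extension of maps into all members of [B], which the kernels given
   by [decomposition] satisfy and from which [extN] extends maps into [N]. *)
apply/BA; apply: (right_perp_of_decomposition hlim freeL extN) => V AV V0.
apply: (decomposition KR KI KF freeL AF' _ scK AV V0) => Q C AQ BC.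
by have /AB := AQ; apply.
Qed.
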